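(* Suppose that the set $\mathcal{W}$ of Wieferich primes is finite, and put $C_{\mathcal{W}}=\sum_{p\in\mathcal{W}}(A_p-1)\log p$. Then $\Delta_m\le\log m+C_{\mathcal{W}}$ and $L_m\le e^{C_{\mathcal{W}}}m$ for every $m\ge2$. Thus, for every $\varepsilon>0$, the set of integers $m\ge2$ satisfying $E_\varepsilon(\mathcal{V}_m)\ge0$ is finite.
   Context: For $m\ge2$, $\mathcal{V}_m=(1,2^m-1,2^m)$. For a triple $(a,b,c)$ of positive integers with $a+b=c$, $E_\varepsilon(a,b,c)=\log c-(1+\varepsilon)\log\mathrm{rad}(abc)$, where $\mathrm{rad}(n)$ is the product of the distinct primes dividing $n$. Put $L_m=(2^m-1)/\mathrm{rad}(2^m-1)$ and $\Delta_m=\log L_m$. $\mathcal{W}$ is the set of odd primes $p$ with $2^{p-1}\equiv1\pmod{p^2}$. For an odd prime $p$, $d_p$ is the multiplicative order of $2$ modulo $p$ and $A_p=v_p(2^{d_p}-1)$, with $v_p$ the $p$-adic valuation. *)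

(* Defs.v *)
From mathcomp Require Import all_boot all_order all_algebra all_fingroup.
From mathcomp Require Import all_classical all_reals all_analysis.

Set Implicit Arguments.
Unset Strict Implicit.
Unset Printing Implicit Defensive.

Import Order.TTheory GRing.Theory Num.Theory.

Local Open Scope classical_set_scope.
Local Open Scope ring_scope.

Definition rad (n : nat) : nat := (\prod_(p <- primes n) p)%N.

Definition abcE (R : realType) (eps : R) (t : nat * nat * nat) : R :=
  let: (a, b, c) := t in
  ln (c%:R : R) - (1 + eps) * ln ((rad (a * b * c))%:R : R).

Definition Vtriple (m : nat) : nat * nat * nat := (1, 2 ^ m - 1, 2 ^ m)%N.

Definition Lquot (R : realType) (m : nat) : R :=
  (2 ^ m - 1)%N%:R / (rad (2 ^ m - 1))%:R.

Definition Delta (R : realType) (m : nat) : R := ln (Lquot R m).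

Definition wieferich : set nat :=
  [set p | [/\ prime p, odd p & 2 ^ (p - 1) = 1 %[mod p ^ 2]]].

(* The order of 2 in the group of units of 'F_p.  [insubd] views 2 as a unit;
   its default value 1 is only used when 2 is not one, which cannot happen for
   an odd prime p, the only case of interest. *)
Definition ord2 (p : nat) : nat :=
  #[insubd (1%g : {unit 'F_p}) (2%:R : 'F_p)]%g.

Definition Aval (p : nat) : nat := logn p (2 ^ ord2 p - 1).

Definition CW (R : realType) : R :=
  \sum_(p \in wieferich) (((Aval p)%:R - 1) * ln (p%:R : R)).

(* Main.v *)
Require Import Defs.
From mathcomp Require Import all_boot all_order all_algebra all_fingroup.
From mathcomp Require Import all_solvable finmap.
From mathcomp Require Import all_classical all_reals all_analysis.
From mathcomp Require Import ring lra zify.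

(** Write N = 2^m - 1.  An odd prime p divides N exactly when the order d_p of 2
    modulo p divides m, and then lifting the exponent, applied to
    N = (2^d_p)^(m / d_p) - 1, gives v_p(N) = A_p + v_p(m / d_p), hence
    v_p(N) <= A_p + v_p(m) ([logn_mersenne_le]).  If A_p >= 2 then p^2 divides
    2^d_p - 1, which divides 2^(p-1) - 1, so p is a Wieferich prime
    ([wieferich_Aval_gt1]).  When there are finitely many Wieferich primes, the
    integer K, the product of p^(A_p - 1) over them, thus absorbs every excess
    A_p - 1, and comparing valuations prime by prime yields

      N divides rad(N) * m * K    ([mersenne_dvd]).

    Since K = exp(C_W) ([expR_CW]), this is the bound L_m <= exp(C_W) m, and its
    logarithm is the bound on Delta_m.

    For the finiteness, rad(N 2^m) = 2 rad(N) and 2^m <= 2N, so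
    m ln 2 <= ln rad(abc) + ln m + C_W.  If E_eps >= 0, that is
    (1 + eps) ln rad(abc) <= m ln 2, then
    eps m ln 2 <= (1 + eps) (ln m + C_W), and a linear function of m exceeds
    a logarithmic one from some point on ([finite_linear_le_ln]). *)

Set Implicit Arguments.
Unset Strict Implicit.
Unset Printing Implicit Defensive.

Import Order.TTheory GRing.Theory Num.Theory.
Import Defs.

(** * Lifting the exponent *)

(** The quotient ((1 + y)^n - 1) / y modulo y^2: its constant term decides the
    valuation when p does not divide n, its linear term is needed for n = p. *)
Lemma geometric_sum_expansion (y n : nat) :
  exists c, \sum_(i < n) y.+1 ^ i = n + y * 'C(n, 2) + y ^ 2 * c.
Proof.
elim: n => [|n [c IHn]]; first by exists 0; rewrite big_ord0 bin0n; lia.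
exists ('C(n, 2) + c + y * c); rewrite big_ord_recl expn0 binS bin1.
under eq_bigr => i _ do rewrite lift0 expnS.
rewrite -big_distrr /= IHn; ring.
Qed.

Lemma logn_sum_coprime (p y k : nat) : prime p -> p %| y -> ~~ (p %| k) ->
  logn p (\sum_(i < k) y.+1 ^ i) = 0.
Proof.
move=> p_pr p_y p_k; have [c ->] := geometric_sum_expansion y k.
apply: logn_coprime; rewrite prime_coprime //.
rewrite -addnA addnC dvdn_addr // dvdn_add //; first exact: dvdn_mulr.
by rewrite expnS -mulnA dvdn_mulr.
Qed.

(** The sum is congruent to p modulo p^2: p divides both y and 'C(p, 2), the
    latter because p is odd. *)
Lemma logn_sum_prime (p y : nat) : prime p -> odd p -> p %| y ->
  logn p (\sum_(i < p) y.+1 ^ i) = 1.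
Proof.
move=> p_pr p_odd p_y; have p_gt0 := prime_gt0 p_pr.
have [c ->] := geometric_sum_expansion y p.
have p2_bin : p ^ 2 %| y * 'C(p, 2).
  rewrite expnS expn1 dvdn_mul // prime_dvd_bin //.
  exact: odd_prime_gt2 p_odd p_pr.
have p2_rest : p ^ 2 %| y * 'C(p, 2) + y ^ 2 * c.
  by rewrite dvdn_add // dvdn_mulr // dvdn_exp2r.
have S_gt0 : 0 < p + y * 'C(p, 2) + y ^ 2 * c by rewrite -addnA addn_gt0 p_gt0.
apply/eqP; rewrite eqn_leq -[_ <= 1]negbK -ltnNge -!pfactor_dvdn //.
rewrite -addnA; apply/andP; split; last first.
  by rewrite expn1 dvdn_addr // (dvdn_trans _ p2_rest) // dvdn_mulr.
rewrite dvdn_addl // -[X in _ %| X]expn1 dvdn_Pexp2l //; exact: prime_gt1.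
Qed.

(** Lifting the exponent.  With k = p^a k' and p not dividing k', each of the
    a successive p-th powers adds one to the valuation of x - 1, and the final
    power k' adds nothing. *)
Lemma logn_subX1 (p x k : nat) : prime p -> odd p -> 1 < x -> p %| x - 1 ->
  0 < k -> logn p (x ^ k - 1) = logn p (x - 1) + logn p k.
Proof.
move=> p_pr p_odd.
have step z n : 1 < z -> 0 < n -> logn p (z ^ n - 1) =
    logn p (z - 1) + logn p (\sum_(i < n) (z - 1).+1 ^ i).
  case: z => // y y_gt0 n_gt0; rewrite subSS subn0 [in LHS]subn1 predn_exp /=.
  by rewrite lognM //; case: n n_gt0 => // n _; rewrite big_ord_recl.
move=> x_gt1 p_x k_gt0.
have [k' p_k' ->] := pfactor_coprime p_pr k_gt0.
rewrite prime_coprime // in p_k'.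
have k'_gt0 : 0 < k' by case: k' p_k' => //; rewrite dvdn0.
set a := logn p k; have powX : [/\ 1 < x ^ p ^ a, p %| x ^ p ^ a - 1 &
    logn p (x ^ p ^ a - 1) = logn p (x - 1) + a].
  elim: a => [|a [gt1 dvd IHa]]; first by rewrite expn0 expn1 addn0.
  rewrite expnSr expnM.
  have gt1' : 1 < (x ^ p ^ a) ^ p by rewrite -[1](exp1n p) ltn_exp2r ?prime_gt0.
  split=> //; last by rewrite step ?prime_gt0 // logn_sum_prime // IHa addn1 addnS.
  by rewrite subn1 predn_exp -subn1 dvdn_mulr.
case: powX => gt1 dvd logX.
rewrite [in LHS]mulnC expnM step // logn_sum_coprime // addn0 logX.
by rewrite logn_Gauss ?prime_coprime // pfactorK.
Qed.

(** * Valuations of Mersenne numbers *)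

Lemma mersenne_gt0 (m : nat) : 0 < m -> 0 < 2 ^ m - 1.
Proof. by move=> m_gt0; rewrite subn_gt0 -{1}(expn0 2) ltn_exp2l. Qed.

Lemma odd_mersenne (m : nat) : 0 < m -> odd (2 ^ m - 1).
Proof. by case: m => // m _; rewrite oddB ?expn_gt0 // oddX. Qed.

Lemma dvdn_ord2 (p m : nat) : prime p -> odd p ->
  (ord2 p %| m) = (p %| 2 ^ m - 1).
Proof.
move=> p_pr p_odd; have charFp := pchar_Fp p_pr.
have u2 : (2%:R : 'F_p)%R \is a GRing.unit.
  rewrite unitfE -(dvdn_pcharf charFp) gtnNdvd //.
  exact: odd_prime_gt2 p_odd p_pr.
rewrite order_dvdn -val_eqE FinRing.val_unitX insubdK //=.
by rewrite (dvdn_pcharf charFp) natrB ?expn_gt0 // natrX subr_eq0.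
Qed.

Lemma logn_mersenne_le (p m : nat) : prime p -> odd p -> 0 < m ->
  p %| 2 ^ m - 1 -> logn p (2 ^ m - 1) <= Aval p + logn p m.
Proof.
move=> p_pr p_odd m_gt0 p_N.
have p_ord : p %| 2 ^ ord2 p - 1 by rewrite -dvdn_ord2.
have [k def_m] : exists k, m = k * ord2 p.
  by apply/dvdnP; rewrite dvdn_ord2.
move: m_gt0; rewrite def_m muln_gt0 => /andP[k_gt0 d_gt0].
rewrite [k * _]mulnC expnM logn_subX1 //; last first.
  by rewrite -subn_gt0 mersenne_gt0.
by rewrite leq_add2l dvdn_leq_log ?muln_gt0 ?k_gt0 ?d_gt0 // dvdn_mull.
Qed.

Lemma Aval_gt0 (p : nat) : prime p -> odd p -> 0 < Aval p.
Proof.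
move=> p_pr p_odd; have p_ord : p %| 2 ^ ord2 p - 1 by rewrite -dvdn_ord2.
by rewrite logn_gt0 mem_primes p_pr p_ord mersenne_gt0 // order_gt0.
Qed.

(** By Euler's theorem d_p divides p - 1, so a square p^2 dividing 2^d_p - 1
    also divides 2^(p-1) - 1. *)
Lemma wieferich_Aval_gt1 (p : nat) : prime p -> odd p -> 1 < Aval p ->
  wieferich p.
Proof.
move=> p_pr p_odd A_gt1; split=> //.
have two_p : coprime 2 p.
  by rewrite coprime_sym prime_coprime // gtnNdvd // odd_prime_gt2.
have d_p1 : ord2 p %| p - 1.
  rewrite dvdn_ord2 // -eqn_mod_dvd ?expn_gt0 //.
  by rewrite subn1 -totient_prime // Euler_exp_totient.
apply/eqP; rewrite eqn_mod_dvd ?expn_gt0 //.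
apply: (@dvdn_trans (2 ^ ord2 p - 1)).
  by rewrite pfactor_dvdn // mersenne_gt0 // order_gt0.
case/dvdnP: d_p1 => k ->; rewrite mulnC expnM !subn1 [X in _ %| X]predn_exp.
exact: dvdn_mulr.
Qed.

(** * Radicals *)

Lemma rad_gt0 (n : nat) : 0 < rad n.
Proof.
rewrite /rad big_seq; apply: prodn_cond_gt0 => p.
by rewrite mem_primes => /andP[/prime_gt0].
Qed.

Lemma prime_dvd_rad (p n : nat) : p \in primes n -> p %| rad n.
Proof. by move=> p_n; rewrite /rad (big_rem p) //= dvdn_mulr. Qed.

Lemma rad_coprimeM (a b : nat) : 0 < a -> 0 < b -> coprime a b ->
  rad (a * b) = rad a * rad b.
Proof.
move=> a_gt0 b_gt0 co_ab; rewrite /rad -big_cat; apply: perm_big.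
apply: uniq_perm; first exact: primes_uniq.
  by rewrite cat_uniq !primes_uniq -coprime_has_primes ?co_ab.
by move=> p; rewrite mem_cat primesM.
Qed.

Lemma rad_Vtriple (m : nat) : 0 < m ->
  rad (1 * (2 ^ m - 1) * 2 ^ m) = 2 * rad (2 ^ m - 1).
Proof.
move=> m_gt0; rewrite mul1n rad_coprimeM ?expn_gt0 //; last first.
- by rewrite coprimeXr // coprimen2 odd_mersenne.
- exact: mersenne_gt0.
by rewrite {2}/rad primesX // primes_prime // big_seq1 mulnC.
Qed.

(** * The contribution of the Wieferich primes *)

(** The integer whose logarithm is C_W. *)
Definition wieferich_excess : nat :=
  \prod_(p <- fset_set wieferich) p ^ (Aval p).-1.

Lemma wieferich_excess_gt0 : finite_set wieferich -> 0 < wieferich_excess.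
Proof.
move=> finW; rewrite /wieferich_excess big_seq; apply: prodn_cond_gt0 => p.
by rewrite in_fset_set // inE => -[/prime_gt0 p_gt0 _ _]; rewrite expn_gt0 p_gt0.
Qed.

(** In the bound v_p(N) <= 1 + (A_p - 1) + v_p(m), the radical accounts for 1
    and m for v_p(m); the middle term is positive only for Wieferich primes,
    and then p^(A_p - 1) is a factor of [wieferich_excess]. *)
Lemma mersenne_dvd (m : nat) : finite_set wieferich -> 0 < m ->
  2 ^ m - 1 %| rad (2 ^ m - 1) * (m * wieferich_excess).
Proof.
move=> finW m_gt0; have K_gt0 := wieferich_excess_gt0 finW.
have N_gt0 := mersenne_gt0 m_gt0.
apply/dvdn_partP => // p p_N.
have [p_pr _ p_dvd] : [/\ prime p, 0 < 2 ^ m - 1 & p %| 2 ^ m - 1].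
  by move: p_N; rewrite mem_primes => /and3P.
have p_odd : odd p by rewrite (dvdn_odd p_dvd) // odd_mersenne.
have r_gt0 := rad_gt0 (2 ^ m - 1).
rewrite p_part pfactor_dvdn ?muln_gt0 ?r_gt0 ?m_gt0 //.
apply: (leq_trans (logn_mersenne_le p_pr p_odd m_gt0 p_dvd)).
rewrite !lognM ?muln_gt0 ?m_gt0 //.
have : 1 <= logn p (rad (2 ^ m - 1)).
  by rewrite -pfactor_dvdn // expn1 prime_dvd_rad.
suff : Aval p <= (logn p wieferich_excess).+1 by lia.
have [A_le1|A_gt1] := leqP (Aval p) 1; first exact: leq_trans A_le1 _.
rewrite -(prednK (Aval_gt0 p_pr p_odd)) ltnS -pfactor_dvdn //.
rewrite /wieferich_excess (big_rem p) /= ?dvdn_mulr // in_fset_set // inE.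
exact: wieferich_Aval_gt1.
Qed.

(** * From divisibility to logarithms *)

Local Open Scope classical_set_scope.
Local Open Scope ring_scope.

Lemma expR_CW (R : realType) : finite_set wieferich ->
  expR (CW R) = wieferich_excess%:R.
Proof.
move=> finW; rewrite /CW fsbig_finite //= expR_sum /wieferich_excess natr_prod.
rewrite big_seq [RHS]big_seq; apply: eq_bigr => p.
rewrite in_fset_set // inE => -[p_pr p_odd _].
rewrite -subn1 natrX -[RHS]lnK ?posrE ?exprn_gt0 ?ltr0n ?prime_gt0 //.
by rewrite lnXn ?ltr0n ?prime_gt0 // -[ln _ *+ _]mulr_natl natrB // Aval_gt0.
Qed.

(** The tangent bound ln x <= x - 1 at x = d m gives ln m <= d m - ln d; the
    slope d = a / (2 b) makes b ln m absorb only half of a m, so that m stays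
    below an explicit constant. *)
Lemma finite_linear_le_ln (R : realType) (a b c : R) : 0 < a -> 0 < b ->
  finite_set [set m : nat | (0 < m)%N /\ a * m%:R <= b * (ln m%:R + c)].
Proof.
move=> a_gt0 b_gt0; pose d := a / (2 * b).
have d_gt0 : 0 < d by rewrite divr_gt0 // mulr_gt0.
pose B := b * (c - ln d) * 2 / a.
apply: (@sub_finite_set _ _ `I_(Num.truncn B).+1); last exact: finite_II.
move=> m /= [m_gt0 le_m].
have m_gt0' : 0 < m%:R :> R by rewrite ltr0n.
have ln_le : ln m%:R <= d * m%:R - ln d.
  rewrite lerBrDr addrC -lnM ?posrE //.
  have dm_gt0 : 0 < d * m%:R by rewrite mulr_gt0.
  have -> : d * m%:R = 1 + (d * m%:R - 1) by ring.
  by apply: le_trans (le_ln1Dx _) _; lra.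
have bd : b * d = a / 2 by rewrite /d; field; rewrite gt_eqF.
rewrite -(ltr_nat R); apply: le_lt_trans (truncnS_gt B).
rewrite /B ler_pdivlMr //.
have : b * (ln m%:R + c) <= b * (d * m%:R - ln d + c).
  by rewrite ler_pM2l // lerD2r.
have -> : b * (d * m%:R - ln d + c) = a / 2 * m%:R + b * (c - ln d).
  by rewrite -bd; ring.
lra.
Qed.

Theorem theorem6p46 (R : realType) (finW : finite_set wieferich) :
  (forall m : nat, (2 <= m)%N ->
     Delta R m <= ln (m%:R : R) + CW R /\
     Lquot R m <= expR (CW R) * m%:R) /\
  (forall eps : R, 0 < eps ->
     finite_set [set m : nat | (2 <= m)%N /\ 0 <= abcE eps (Vtriple m)]).
Proof.
have K_gt0 := wieferich_excess_gt0 finW.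
have le_N m : (0 < m)%N ->
    (2 ^ m - 1 <= rad (2 ^ m - 1) * (m * wieferich_excess))%N.
  move=> m_gt0; apply: dvdn_leq; last exact: mersenne_dvd.
  by rewrite !muln_gt0 rad_gt0 m_gt0.
split=> [m m_ge2 | eps eps_gt0].
  have m_gt0 : (0 < m)%N by apply: leq_trans m_ge2.
  have L_le : Lquot R m <= expR (CW R) * m%:R.
    rewrite expR_CW // /Lquot ler_pdivrMr ?ltr0n ?rad_gt0 //.
    by rewrite -!natrM ler_nat mulnC [(_ * m)%N]mulnC le_N.
  have L_gt0 : 0 < Lquot R m.
    by rewrite divr_gt0 ?ltr0n ?rad_gt0 // mersenne_gt0.
  have bound_gt0 : 0 < expR (CW R) * m%:R by rewrite mulr_gt0 ?expR_gt0 ?ltr0n.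
  split=> //; rewrite /Delta -[CW R]expRK addrC -lnM ?posrE ?expR_gt0 ?ltr0n //.
  by rewrite ler_ln ?posrE.
have ln2_gt0 : 0 < ln 2 :> R by rewrite ln_gt0 // ltr1n.
apply: (@sub_finite_set _ _ _ _ (@finite_linear_le_ln R (eps * ln 2) (1 + eps)
  (CW R) _ _)); [|exact: mulr_gt0|by rewrite addr_gt0].
move=> m /= [m_ge2]; have m_gt0 : (0 < m)%N by apply: leq_trans m_ge2.
rewrite /abcE /Vtriple rad_Vtriple //; set r := rad _ => E_ge0; split=> //.
have r_gt0 : (0 < r)%N := rad_gt0 _.
have ln_2m : ln (2 ^ m)%:R = m%:R * ln 2 :> R.
  by rewrite natrX lnXn // mulr_natl.
have le_2m : m%:R * ln 2 <= ln (2 * r)%:R + (ln m%:R + CW R).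
  rewrite -ln_2m -[CW R]expRK expR_CW // -!lnM ?posrE -?natrM ?ltr0n ?muln_gt0
    ?r_gt0 ?m_gt0 ?K_gt0 //.
  rewrite ler_ln ?posrE ?ltr0n ?muln_gt0 ?r_gt0 ?m_gt0 ?K_gt0 ?expn_gt0 //.
  rewrite ler_nat; have : (2 <= 2 ^ m)%N by rewrite -{1}(expn1 2) leq_exp2l.
  have := le_N m m_gt0; rewrite -/r -[(2 * r * _)%N]mulnA; lia.
move: E_ge0; rewrite ln_2m => E_ge0.
have : (1 + eps) * (m%:R * ln 2) <=
    (1 + eps) * (ln (2 * r)%:R + (ln m%:R + CW R)).
  by rewrite ler_pM2l // addr_gt0.
lra.
Qed.
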